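(* Let $k, r, \delta$ be integers with $r\ge 2$, $\delta\ge 2$ and $r<k$, and let $\mu = \left\lceil \frac{(k-1)(\delta-1)+1}{(r-1)(\delta-1)+1}\right\rceil -1$. For every integer $n\ge k(r(\delta-1)+1)$ and every sufficiently large prime power $q$ (i.e. every prime power $q\ge q_0$ for some $q_0$ depending on $n,k,r,\delta$), there exists an optimal $[n,k,d]_q$ linear code with information $(r,\delta)_c$-locality; that is, there exists an $[n,k,d]_q$ linear code with information $(r,\delta)_c$-locality such that $n=d+k-1+\mu$.
   Context: An $[n,k,d]_q$ linear code is a $k$-dimensional linear subspace $\mathcal{C}\subseteq\mathbb{F}_q^n$ with minimum (Hamming) distance $d$. Let $G=(g_1,\dots,g_n)$ be a $k\times n$ generator matrix of $\mathcal{C}$, with columns $g_i\in\mathbb{F}_q^k$. Write $[n]=\{1,\dots,n\}$; for $N\subseteq[n]$ let $\operatorname{span}(N)$ be the $\mathbb{F}_q$-linear span of $\{g_i: i\in N\}$ and $\operatorname{rank}(N)$ its dimension. A set $I\subseteq[n]$ is an information set if $|I|=\operatorname{rank}(I)=k$. The $i$-th coordinate of $\mathcal{C}$ has $(r,\delta)_c$-locality if there exist $\delta-1$ pairwise disjoint sets $R^{(i)}_1,\dots,R^{(i)}_{\delta-1}\subseteq[n]\setminus\{i\}$ such that for every $1\le\xi\le\delta-1$: $|R^{(i)}_\xi|\le r$ and $g_i\in\operatorname{span}(R^{(i)}_\xi)$. The code $\mathcal{C}$ has information $(r,\delta)_c$-locality if there is an information set $I$ such that every coordinate $i\in I$ has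 $(r,\delta)_c$-locality. A code with information $(r,\delta)_c$-locality is called optimal if $n=d+k-1+\mu$, with $\mu$ as in the claim. *)

(* Defs.v *)
From HB Require Import structures.
From mathcomp Require Import all_boot all_order all_algebra.

Set Implicit Arguments.
Unset Strict Implicit.
Unset Printing Implicit Defensive.

Import Order.TTheory GRing.Theory Num.Theory.
Local Open Scope ring_scope.

Definition hamming_dist (F : finFieldType) (n : nat) (u v : 'rV[F]_n) : nat :=
  #|[set i : 'I_n | u 0 i != v 0 i]|.

Definition min_distance (F : finFieldType) (n : nat)
    (C : {vspace 'rV[F]_n}) (d : nat) : Prop :=
  (exists u v : 'rV[F]_n,
     [/\ u \in C, v \in C, u != v & hamming_dist u v = d])
  /\ (forall u v : 'rV[F]_n,
     u \in C -> v \in C -> u != v -> (d <= hamming_dist u v)%N).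

(* C is an [n, k, d]_q linear code, with q = #|F|. *)
Definition linear_code (F : finFieldType) (n k d : nat)
    (C : {vspace 'rV[F]_n}) : Prop :=
  \dim C = k /\ min_distance C d.

Definition generator_matrix (F : finFieldType) (n k : nat)
    (C : {vspace 'rV[F]_n}) (G : 'M[F]_(k, n)) : Prop :=
  basis_of C [tuple row i G | i < k].

Definition col_span (F : finFieldType) (n k : nat) (G : 'M[F]_(k, n))
    (N : {set 'I_n}) : {vspace 'cV[F]_k} :=
  <<[seq col i G | i in N]>>%VS.

Definition col_rank (F : finFieldType) (n k : nat) (G : 'M[F]_(k, n))
    (N : {set 'I_n}) : nat :=
  \dim (col_span G N).

Definition information_set (F : finFieldType) (n k : nat) (G : 'M[F]_(k, n))
    (I : {set 'I_n}) : Prop :=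
  #|I| = k /\ col_rank G I = k.

Definition locality (F : finFieldType) (n k : nat) (G : 'M[F]_(k, n))
    (r delta : nat) (i : 'I_n) : Prop :=
  exists R : 'I_(delta - 1) -> {set 'I_n},
    (forall x y, x != y -> [disjoint R x & R y]) /\
    (forall x, [/\ i \notin R x, (#|R x| <= r)%N & col i G \in col_span G (R x)]).

(* Whether coordinates have locality, or form an information set, does not
   depend on the generator matrix chosen, so [exists G] is the same as
   [for every G] here. *)
Definition information_locality (F : finFieldType) (n k : nat)
    (C : {vspace 'rV[F]_n}) (r delta : nat) : Prop :=
  exists G : 'M[F]_(k, n),
    generator_matrix C G /\
    exists I : {set 'I_n},
      information_set G I /\ (forall i, i \in I -> locality G r delta i).

Definition mu (k r delta : nat) : int :=
  Num.ceil (((k%:R - 1) * (delta%:R - 1) + 1)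
            / ((r%:R - 1) * (delta%:R - 1) + 1) : rat) - 1.

(* Optimality is an equation in int, since mu is a ceiling in int. *)
Definition optimal_code (F : finFieldType) (n k d r delta : nat)
    (C : {vspace 'rV[F]_n}) : Prop :=
  [/\ linear_code k d C,
      information_locality k C r delta
    & n%:Z = d%:Z + k%:Z - 1 + mu k r delta].

(* Main.v *)
Require Import Defs.
From HB Require Import structures.
From mathcomp Require Import all_boot all_order all_algebra.
From mathcomp Require Import zify ring.

(** Let R(i, xi) be disjoint r-sets avoiding the k "hub" coordinates, and let C0
    be the code of all words whose i-th hub entry is the sum of the entries over
    R(i, xi), for every xi < t = delta - 1.  Every subcode of C0 has the locality
    property at the hubs.  If N contains m of the sets R(i, xi), then C0
    restricts onto at least max (|N| - m, (r - 1) m + m / t) coordinates of the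
    closure of N, which is at least k as soon as |N| >= k + mu.  So the words of
    C0 vanishing on such an N form a subspace of codimension at least k, and over
    a large field some k-dimensional C in C0 meets all these subspaces trivially:
    its distance is at least n - k + 1 - mu.  Conversely, k - 1 coordinates can
    be chosen to determine mu further ones, so a nonzero word of C vanishes on
    k - 1 + mu coordinates. *)

Set Implicit Arguments.
Unset Strict Implicit.
Unset Printing Implicit Defensive.
Import Order.TTheory GRing.Theory Num.Theory.
Local Open Scope ring_scope.

(** * Subspaces in general position over a large field *)

(** Induction on [Us]: if the [v] found for the tail falls in the head [U], move along the line
    [w + a *: v] with [w] in [W] outside [U]. No point of it lies in [U], and each other subspace
    contains at most one, since two would put [v] in it; so some scalar is left over. *)
Lemma exists_vector_avoiding (F : finFieldType) (V : vectType F)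
    (W : {vspace V}) (Us : seq {vspace V}) :
  (size Us < #|F|)%N -> {in Us, forall U : {vspace V}, ~~ (W <= U)%VS} ->
  exists2 v, v \in W & {in Us, forall U : {vspace V}, v \notin U}.
Proof.
elim: Us => [_ _|U Us IH /= szU nWU]; first by exists 0; rewrite ?mem0v.
have [U' U'Us|v vW vUs] := IH (ltnW szU); first by rewrite nWU ?inE ?U'Us ?orbT.
have [vU|vU] := boolP (v \in U); last first.
  by exists v => // U'; rewrite inE => /predU1P[->|/vUs].
have /subvPn[w wW wU] : ~~ (W <= U)%VS by rewrite nWU ?mem_head.
(* [hit a] is the index of the first subspace containing the point, or [size Us] if there is
   none. *)
pose hits a (U' : {vspace V}) := w + a *: v \in U'; pose hit a := find (hits a) Us.
have hit_inj a b : (hit a < size Us)%N -> hit a = hit b -> a = b.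
  move=> ha hab; have hb : (hit b < size Us)%N by rewrite -hab.
  have aU : hits a (nth 0%VS Us (hit a)) by rewrite nth_find // has_find.
  have bU : hits b (nth 0%VS Us (hit a)) by rewrite hab nth_find // has_find.
  have := memvB aU bU; rewrite opprD addrACA subrr add0r -scalerBl => abv.
  apply/eqP; rewrite -subr_eq0; apply: contraT => nz_ab.
  have := vUs _ (mem_nth 0%VS ha).
  by rewrite -[v](scalerK nz_ab) memvZ.
have [a aP] : exists a, ~~ (hit a < size Us)%N.
  apply/existsP; rewrite -negb_forall; apply/negP => /forallP hitP.
  have : injective (fun a => Ordinal (hitP a)).
    by move=> a b [] hab; apply: hit_inj.
  by move/leq_card; rewrite card_ord leqNgt (ltnW szU).
exists (w + a *: v); first by rewrite memvD ?memvZ.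
move=> U'; rewrite inE => /predU1P[->|U'Us].
  by apply: contra wU => wavU; rewrite -(addrK (a *: v) w) memvB ?memvZ.
by move: aP; rewrite -has_find => /hasPn/(_ _ U'Us).
Qed.

(** Induction on [k]: pick [v] outside every [U], then avoid all [U + <[v]>] with a space of
    dimension one less, and add [<[v]>] to it. Having [U0] in the list forces [v] to be nonzero. *)
Lemma exists_subspace_avoiding (F : finFieldType) (V : vectType F)
    (W U0 : {vspace V}) (Us : seq {vspace V}) (k : nat) :
  (size Us < #|F|)%N -> U0 \in Us ->
  {in Us, forall U : {vspace V}, (U <= W)%VS /\ (\dim U + k <= \dim W)%N} ->
  exists C : {vspace V},
    [/\ (C <= W)%VS, \dim C = k & {in Us, forall U : {vspace V}, (U :&: C)%VS = 0%VS}].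
Proof.
elim: k U0 Us => [|k IH] U0 Us szU U0Us UsW.
  by exists 0%VS; split; rewrite ?sub0v ?dimv0 // => U _; rewrite capv0.
have [|v vW vUs] := exists_vector_avoiding (W := W) szU.
  move=> U /UsW[_ dU]; apply/negP => /dimvS; lia.
have [|||C [CW dC CUs]] := IH (U0 + <[v]>)%VS [seq (U + <[v]>)%VS | U <- Us].
- by rewrite size_map.
- exact: map_f.
- move=> _ /mapP[U UUs ->]; have [UW dU] := UsW U UUs.
  split; first by rewrite subv_add UW -memvE.
  apply: leq_trans dU; rewrite addnS -addSn leq_add2r.
  by rewrite (leq_trans (dimv_add_leqif _ _)) // dim_vline -addn1 leq_add2l leq_b1.
have CUs0 U u : U \in Us -> u \in (U + <[v]>)%VS -> u \in C -> u = 0.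
  move=> UUs uU uC; apply/eqP; rewrite -memv0.
  by rewrite -(CUs _ (map_f _ UUs)) memv_cap uU.
have nz_v : v != 0 by apply: contraNneq (vUs _ U0Us) => ->; rewrite mem0v.
exists (<[v]> + C)%VS; split; first by rewrite subv_add CW -memvE vW.
  rewrite dimv_disjoint_sum ?dim_vline ?nz_v ?dC //.
  apply/eqP; rewrite -subv0; apply/subvP => u.
  rewrite memv_cap => /andP[uv uC]; rewrite memv0; apply/eqP.
  by apply: CUs0 U0Us _ uC; apply: (subvP (addvSr _ _)).
move=> U UUs; apply/eqP; rewrite -subv0; apply/subvP => u.
rewrite memv_cap => /andP[uU /memv_addP[_ /vlineP[a ->] [w wC uE]]].
have w0 : w = 0.
  apply: CUs0 UUs _ wC; rewrite -[w](addKr (a *: v)) -uE addrC memv_add //.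
  by rewrite memvN memvZ ?memv_line.
move: uU; rewrite uE w0 addr0 memv0 scaler_eq0 (negPf nz_v) orbF => avU.
by apply: contraNT (vUs _ UUs) => nz_a; rewrite -[v](scalerK nz_a) memvZ.
Qed.

Lemma exists_subset_card (T : finType) (A : {set T}) (m : nat) :
  (m <= #|A|)%N -> exists2 B : {set T}, B \subset A & #|B| = m.
Proof.
move=> mA; exists [set x in take m (enum A)].
  by apply/subsetP => x; rewrite inE => /mem_take; rewrite mem_enum.
rewrite cardsE (card_uniqP _) ?take_uniq ?enum_uniq //.
by rewrite size_takel // -cardE.
Qed.

(** * The code of the local checks and its subcodes *)

Section LocalCode.

Variables (F : finFieldType) (n k t r : nat).
Variables (hub : 'I_k -> 'I_n) (R : 'I_k * 'I_t -> {set 'I_n}).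

Definition vanish (J : {set 'I_n}) : {vspace 'rV[F]_n} :=
  lker (linfun (colsub (enum_val : 'I_#|J| -> 'I_n))).

Lemma vanishP (J : {set 'I_n}) (c : 'rV[F]_n) :
  reflect {in J, forall j, c 0 j = 0} (c \in vanish J).
Proof.
rewrite memv_ker lfunE /=; apply: (iffP eqP) => [/rowP cJ j jJ | cJ].
  by have := cJ (enum_rank_in jJ j); rewrite !mxE enum_rankK_in.
by apply/rowP => x; rewrite !mxE cJ ?enum_valP.
Qed.

Lemma dim_vanish (W : {vspace 'rV[F]_n}) (J : {set 'I_n}) :
  (\dim W <= \dim (W :&: vanish J) + #|J|)%N.
Proof.
rewrite -[X in (X <= _)%N](limg_ker_dim (linfun (colsub (enum_val : 'I_#|J| -> 'I_n)))).
rewrite leq_add2l (leq_trans (dimvS (subvf _))) // dimvf dim_matrix.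
by rewrite mul1r.
Qed.

Definition local_check (p : 'I_k * 'I_t) : 'cV[F]_n :=
  delta_mx (hub p.1) 0 - \sum_(j in R p) delta_mx j 0.

(** The code C0: a pair [p] stands for (i, xi), so each hub [i] has [t] checks. *)
Definition local_code : {vspace 'rV[F]_n} :=
  (\bigcap_p lker (linfun (mulmxr (local_check p))))%VS.

Lemma local_codeP (c : 'rV[F]_n) :
  reflect (forall p, c 0 (hub p.1) = \sum_(j in R p) c 0 j) (c \in local_code).
Proof.
have memE p : (c \in lker (linfun (mulmxr (local_check p)))) =
    (c 0 (hub p.1) == \sum_(j in R p) c 0 j).
  rewrite memv_ker lfunE /= /local_check mulmxBr mulmx_sumr -colE subr_eq0.
  rewrite (eq_bigr (fun j => col j c)) => [|j _]; last by rewrite -colE.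
  apply/eqP/eqP => [/matrixP/(_ 0 0)|hc].
    by rewrite summxE !mxE => ->; apply: eq_bigr => j _; rewrite mxE.
  apply/matrixP => x y; rewrite summxE !mxE !ord1 hc.
  by apply: eq_bigr => j _; rewrite mxE.
rewrite memvE; apply: (iffP subv_bigcapP) => hc p => [|_].
  by apply/eqP; rewrite -memE memvE hc.
by rewrite -memvE memE hc.
Qed.

(** A distance is [n] minus the number of zeros of the difference. A nonzero word of [C] has at most
    [#|N|] zeros, and [c] has that many. *)
Lemma min_distance_vanish (C : {vspace 'rV[F]_n}) (N : {set 'I_n}) c :
    c \in (C :&: vanish N)%VS -> c != 0 ->
    (forall N' : {set 'I_n}, (#|N| < #|N'|)%N -> (C :&: vanish N' = 0)%VS) ->
  min_distance C (n - #|N|).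
Proof.
move=> /memv_capP[cC /vanishP cN] nz_c CN0.
pose zeros (u : 'rV[F]_n) := [set i | u 0 i == 0].
have distE u v : hamming_dist u v = (n - #|zeros (u - v)%R|)%N.
  have -> : hamming_dist u v = #|~: zeros (u - v)|.
    by congr #|pred_of_set _|; apply/setP => i; rewrite !inE !mxE subr_eq0.
  by have := cardsC (zeros (u - v)); rewrite card_ord; lia.
have dist_ge u v : u \in C -> v \in C -> u != v -> (n - #|N| <= hamming_dist u v)%N.
  move=> uC vC uv; rewrite distE leq_sub2l // leqNgt; apply: contra uv => /CN0 CN.
  rewrite -subr_eq0 -memv0 -CN; apply/memv_capP; split; first exact: memvB.
  by apply/vanishP => j; rewrite inE => /eqP.
split=> //; exists c, 0; split; rewrite ?mem0v //.
apply/eqP; rewrite eqn_leq dist_ge ?mem0v // andbT distE subr0 leq_sub2l //.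
by apply/subset_leq_card/subsetP => j jN; rewrite inE cN.
Qed.

Lemma exists_generator_matrix (C : {vspace 'rV[F]_n}) :
  \dim C = k -> exists G : 'M[F]_(k, n), generator_matrix C G.
Proof.
move=> dC; exists (\matrix_(i < k) (vbasis C)`_i).
rewrite /generator_matrix; set X := [tuple _ | _ < _].
suff -> : X = vbasis C :> seq _ by exact: vbasisP.
apply: (@eq_from_nth _ 0); first by rewrite !size_tuple dC.
move=> i; rewrite size_tuple => lik.
by rewrite -[i]/(nat_of_ord (Ordinal lik)) -tnth_nth tnth_mktuple rowK.
Qed.

(** A check satisfied by every row of [G] is a linear relation between its columns. *)
Lemma generator_locality (C : {vspace 'rV[F]_n}) (G : 'M[F]_(k, n)) p :
    (C <= local_code)%VS -> generator_matrix C G ->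
  col (hub p.1) G \in col_span G (R p).
Proof.
move=> /subvP CL /andP[/eqP spanG _].
have -> : col (hub p.1) G = \sum_(j in R p) col j G.
  apply/matrixP => i y; rewrite summxE mxE; under eq_bigr do rewrite mxE.
  have /CL/local_codeP/(_ p) : row i G \in C.
    by rewrite -spanG memv_span //; apply/tnthP; exists i; rewrite tnth_mktuple.
  by rewrite mxE => ->; apply: eq_bigr => j _; rewrite mxE.
by apply: memv_suml => j jR; apply/memv_span/image_f.
Qed.

(** * Dimension counts for disjoint repair sets *)

Hypotheses (r_gt0 : (0 < r)%N) (hub_inj : injective hub).
Hypothesis hubR : forall i p, hub i \notin R p.
Hypothesis disjR : forall p q, p != q -> [disjoint R p & R q].
Hypothesis cardR : forall p, #|R p| = r.

Lemma memR_inj j p q : j \in R p -> j \in R q -> p = q.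
Proof.
by move=> jp jq; apply/eqP; apply: contraTT jq => /disjR/disjointFr/(_ jp)->.
Qed.

(** Each [R p] has a coordinate [x p] outside [J]. Extend [f] by zero and add to coordinate [x p]
    the defect [D p] of check [p]; since [x p] is no hub and lies in no other repair set, the other
    checks are unaffected. *)
Lemma local_code_extend (J : {set 'I_n}) (f : 'I_n -> F) :
  (forall p, ~~ (R p \subset J)) ->
  exists2 c, c \in local_code & {in J, forall j, c 0 j = f j}.
Proof.
move=> nRJ.
have [|x xR xJ] := @fin_all_exists2 _ _ (fun p x => x \in R p) (fun p x => x \notin J).
  by move=> p; apply/subsetPn.
pose g j := if j \in J then f j else 0.
pose D p := g (hub p.1) - \sum_(l in R p) g l.
exists (\row_j (g j + \sum_p (if j == x p then D p else 0))); last first.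
  move=> j jJ; rewrite mxE /g jJ big1 ?addr0 // => p _.
  by case: eqP jJ (xJ p) => // -> ->.
apply/local_codeP => p; rewrite mxE big1 => [|q _]; last first.
  by case: eqP (hubR p.1 q) => // ->; rewrite xR.
under eq_bigr do rewrite mxE.
rewrite big_split /= exchange_big /= (bigD1 p) //= [X in _ = _ + (_ + X)]big1.
  rewrite [X in _ = _ + (X + _)](bigD1 (x p)) //= eqxx [X in _ = _ + (_ + X + _)]big1 => [|l /andP[_ /negPf->]] //.
  by rewrite /D; ring.
move=> q /negP qp; apply: big1 => l lp; case: eqP => // lx.
by case: qp; apply/eqP/esym/(memR_inj lp); rewrite lx.
Qed.

Lemma dim_local_code_vanish (J : {set 'I_n}) :
  (forall p, ~~ (R p \subset J)) ->
  (\dim (local_code :&: vanish J) + #|J|)%N = \dim local_code.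
Proof.
move=> nRJ; pose h := linfun (colsub (enum_val : 'I_#|J| -> 'I_n) : 'rV[F]_n -> _).
rewrite -(limg_ker_dim h local_code); congr (_ + _)%N.
suff -> : (h @: local_code = fullv)%VS by rewrite dimvf dim_matrix mul1r.
apply/eqP; rewrite eqEsubv subvf; apply/subvP => u _; apply/memv_imgP.
(* Reindexes [u] by coordinates: the sum has one term for [j] in [J] and none otherwise. *)
pose f j := \sum_(y | enum_val y == j) u 0 y.
have [c cC cf] := local_code_extend f nRJ.
exists c => //; rewrite lfunE; apply/rowP => y; rewrite mxE cf ?enum_valP //.
by rewrite /f (big_pred1 y) // => z; rewrite /= (inj_eq enum_val_inj).
Qed.

(** A word of C0 that is zero on a whole repair set is zero at its hub. *)
Lemma closure_vanish (N J : {set 'I_n}) :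
    {in J, forall j, j \in N \/ exists2 p, j = hub p.1 & R p \subset N} ->
  (local_code :&: vanish N <= local_code :&: vanish J)%VS.
Proof.
move=> JN; apply/subvP => c /memv_capP[cC /vanishP cN].
apply/memv_capP; split=> //; apply/vanishP => j /JN[/cN//|[p -> /subsetP RN]].
by rewrite (local_codeP _ cC) big1 // => l /RN /cN.
Qed.

Lemma card_hub_repair (B : {set 'I_k}) (P : {set 'I_k * 'I_t}) :
  #|hub @: B :|: \bigcup_(p in P) R p| = (#|B| + r * #|P|)%N.
Proof.
have disj_hub : hub @: B :&: \bigcup_(p in P) R p = set0.
  apply/setP => j; rewrite !inE; apply/andP => -[/imsetP[i _ ->] /bigcupP[p _]].
  by rewrite (negPf (hubR i p)).
have := cardsUI (hub @: B) (\bigcup_(p in P) R p).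
rewrite disj_hub cards0 addn0 card_imset // => ->; congr (_ + _)%N.
pose S p := if p \in P then R p else set0.
rewrite big_mkcond -[\bigcup_p _]/(\bigcup_p S p) -[LHS]sum1_card.
rewrite partition_disjoint_bigcup => [|p q pq].
  under eq_bigr do rewrite sum1_card.
  rewrite mulnC -sum_nat_const [RHS]big_mkcond /=; apply: eq_bigr => p _.
  by rewrite /S; case: ifP; rewrite ?cardR ?cards0.
by rewrite -setI_eq0 /S; do 2!case: ifP => _; rewrite ?setI0 ?set0I ?eqxx // setI_eq0 disjR.
Qed.

(* The two bounds on [M] here and below say that [M] is mu. *)
Lemma dim_local_code_vanish_le (M : nat) (N : {set 'I_n}) :
    (0 < t)%N -> (0 < k)%N ->
    ((k - 1) * t < M.+1 * ((r - 1) * t + 1))%N -> (k + M <= #|N|)%N ->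
  (\dim (local_code :&: vanish N) + k <= \dim local_code)%N.
Proof.
move=> t_gt0 k_gt0 kM leN.
have [|x xR _] := @fin_all_exists2 _ _ (fun p x => x \in R p) (fun _ _ => True).
  by move=> p; have /card_gt0P[x] : (0 < #|R p|)%N by [rewrite cardR]; exists x.
have x_inj : injective x by move=> p q xpq; apply: (memR_inj (xR p)); rewrite xpq.
(* [cN] is the closure of [N]. Dropping one point of each repair set inside [N] gives [J], which
   contains no [R p], so C0 restricts onto [J]. *)
pose P := [set p | R p \subset N]; pose B := [set p.1 | p in P].
pose cN := N :|: hub @: B; pose J := cN :\: x @: P.
have xPN : x @: P \subset N.
  by apply/subsetP => _ /imsetP[p + ->]; rewrite inE => /subsetP; apply.
have RJ p : ~~ (R p \subset J).
  apply/negP => /subsetP RJ; have RN : R p \subset N.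
    apply/subsetP => j jR; move: (RJ j jR); rewrite !inE => /andP[_ /orP[//|]].
    by move=> /imsetP[i _ jE]; rewrite jE (negPf (hubR i p)) in jR.
  by have := RJ _ (xR p); rewrite inE imset_f ?inE.
have JE : #|J| = (#|cN| - #|P|)%N.
  rewrite cardsDS ?card_imset //; exact: subset_trans xPN (subsetUl _ _).
have PB : (#|P| <= #|B| * t)%N.
  rewrite -[X in (_ * X)%N]card_ord -cardsT -cardsX; apply/subset_leq_card/subsetP.
  by move=> p pP; rewrite !inE andbT imset_f.
have cNP : (r * #|P| + #|B| <= #|cN|)%N.
  rewrite addnC -card_hub_repair setUC; apply/subset_leq_card/setSU.
  by apply/bigcupsP => p; rewrite inE.
have leJ : (k <= #|J|)%N.
  have NcN : (#|N| <= #|cN|)%N by apply/subset_leq_card/subsetUl.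
  (* With at most [M] full repair sets, [#|N| - #|P|] is already at least [k]. Otherwise [#|J|] is
     at least [(r - 1) * #|P| + #|B|]; multiply by [t] and use [PB] to contradict [kM]. *)
  rewrite JE; have [PM|PM] := leqP #|P| M; first lia.
  have : (M.+1 * ((r - 1) * t + 1) <= #|P| * ((r - 1) * t + 1))%N by rewrite leq_mul2r PM orbT.
  case: (leqP k (#|cN| - #|P|)) => // ltk.
  have : (((r - 1) * #|P| + #|B|) * t <= (k - 1) * t)%N.
    by rewrite leq_mul2r; apply/orP; right; rewrite mulnBl mul1n; have := leq_pmull #|P| r_gt0; lia.
  lia.
rewrite -(dim_local_code_vanish RJ) leq_add // dimvS //; apply: closure_vanish.
move=> j; rewrite !inE => /andP[_ /orP[jN|]]; first by left.
by move=> /imsetP[_ /imsetP[p pP ->] ->]; right; exists p => //; rewrite inE in pP.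
Qed.

(** [N] consists of some hubs and [M] of their full repair sets; [J] drops one point from each of
    these sets, and the checks recover the dropped values. *)
Lemma exists_independent_closure (M : nat) :
    (0 < t)%N -> (0 < k)%N -> (M * ((r - 1) * t + 1) <= (k - 1) * t)%N ->
  exists J N : {set 'I_n}, [/\ #|J| = (k - 1)%N, #|N| = (k - 1 + M)%N
    & (local_code :&: vanish J <= vanish N)%VS].
Proof.
(* The number [b] of hubs makes [b + (r - 1) * M] equal to [k - 1]; [Mk] then says that these hubs
   have at least [M] repair sets. *)
move=> t_gt0 k_gt0 Mk; pose b := (k - 1 - (r - 1) * M)%N.
have rM : ((r - 1) * M <= k - 1)%N by rewrite -(leq_pmul2r t_gt0); lia.
have [B _ cB] : exists2 B : {set 'I_k}, B \subset setT & #|B| = b.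
  by apply: exists_subset_card; rewrite cardsT card_ord /b -subnDA leq_subr.
have [P PB cP] : exists2 P : {set 'I_k * 'I_t}, P \subset setX B [set: 'I_t] & #|P| = M.
  apply: exists_subset_card; rewrite cardsX cardsT card_ord cB /b.
  have := leq_mul rM (leqnn t); move: Mk.
  by move: (r - 1)%N (k - 1)%N => r' k'; rewrite mulnBl; lia.
have [|x xR _] := @fin_all_exists2 _ _ (fun p x => x \in R p) (fun _ _ => True).
  by move=> p; have /card_gt0P[x] : (0 < #|R p|)%N by [rewrite cardR]; exists x.
have x_inj : injective x by move=> p q xpq; apply: (memR_inj (xR p)); rewrite xpq.
pose N := hub @: B :|: \bigcup_(p in P) R p.
have xN : x @: P \subset N.
  apply/subsetP => _ /imsetP[p pP ->]; rewrite inE; apply/orP; right.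
  by apply/bigcupP; exists p.
have rMM : (M <= r * M)%N by rewrite leq_pmull.
have cN : #|N| = (k - 1 + M)%N.
  by rewrite card_hub_repair cB cP /b; move: rM; rewrite mulnBl mul1n; lia.
exists (N :\: x @: P), N; split=> //.
  by rewrite cardsDS // card_imset // cP cN addnK.
apply/subvP => c /memv_capP[/local_codeP cC /vanishP cJ]; apply/vanishP => j jN.
have [/imsetP[p pP ->] | jx] := boolP (j \in x @: P); last first.
  by apply: cJ; rewrite inE jx.
have := cC p; rewrite cJ => [|]; last first.
  rewrite !inE imset_f ?orTb ?andbT; last by have /subsetP/(_ p pP) := PB; rewrite !inE andbT.
  by apply/imsetP => -[q _ hq]; have := hubR p.1 q; rewrite hq xR.
rewrite (bigD1 (x p)) //= big1 ?addr0 => [<-|l /andP[lp lx]] //.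
apply: cJ; rewrite !inE; apply/andP; split; last first.
  by apply/orP; right; apply/bigcupP; exists p.
by apply/imsetP => -[q _ lq]; move: lx; rewrite lq (memR_inj lp (q := q)) ?eqxx // lq.
Qed.

(** A combination of rows that is zero at the hubs is a word of [C] vanishing there, hence zero; so
    the hub columns form an invertible matrix. *)
Lemma generator_hub_rank (C : {vspace 'rV[F]_n}) (G : 'M[F]_(k, n)) :
    generator_matrix C G -> (C :&: vanish (hub @: [set: 'I_k]) = 0)%VS ->
  information_set G (hub @: [set: 'I_k]).
Proof.
move=> /andP[/eqP spanG /freeP freeG] C0.
split; first by rewrite card_imset // cardsT card_ord.
have unitG : colsub hub G \in unitmx.
  rewrite -row_free_unit; apply: inj_row_free => v vG.
  have vGC : v *m G \in C.
    rewrite mulmx_sum_row memv_suml // => i _; rewrite memvZ // -spanG memv_span //.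
    by apply/tnthP; exists i; rewrite tnth_mktuple.
  have : v *m G \in (C :&: vanish (hub @: [set: 'I_k]))%VS.
    apply/memv_capP; split=> //; apply/vanishP => _ /imsetP[i _ ->].
    by have /rowP/(_ i) := vG; rewrite !mxE => {2}<-; apply: eq_bigr => j _; rewrite mxE.
  rewrite C0 memv0 mulmx_sum_row => /eqP v0; apply/rowP => i; rewrite mxE.
  apply: (freeG (v 0)); rewrite -[RHS]v0; apply: eq_bigr => j _.
  by rewrite -tnth_nth tnth_mktuple.
suff colG : col_span G (hub @: [set: 'I_k]) = fullv.
  by rewrite /col_rank colG dimvf dim_matrix mulr1.
apply/eqP; rewrite eqEsubv subvf; apply/subvP => w _.
rewrite -[w](mulKVmx unitG); set u := _ *m w.
have -> : colsub hub G *m u = \sum_i u i 0 *: col (hub i) G.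
  apply/matrixP => x y; rewrite !mxE summxE ord1; apply: eq_bigr => i _.
  by rewrite !mxE mulrC.
by apply: memv_suml => i _; apply/memvZ/memv_span/image_f; rewrite imset_f.
Qed.

Lemma exists_optimal_subcode (M : nat) :
    (0 < t)%N -> (0 < k)%N -> (M * ((r - 1) * t + 1) <= (k - 1) * t)%N ->
    ((k - 1) * t < M.+1 * ((r - 1) * t + 1))%N -> (2 ^ n + 1 < #|F|)%N ->
  exists C : {vspace 'rV[F]_n},
    [/\ (C <= local_code)%VS, \dim C = k, min_distance C (n - (k - 1 + M)),
        (C :&: vanish (hub @: [set: 'I_k]) = 0)%VS & (k - 1 + M <= n)%N].
Proof.
move=> t_gt0 k_gt0 leM ltM ltF; pose I := hub @: [set: 'I_k].
have cI : #|I| = k by rewrite card_imset // cardsT card_ord.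
(* The large sets give the distance, and the hub set [I] makes the hubs an information set. This is
   at most [2 ^ n + 1] sets. *)
pose Ns := I :: enum [set N : {set 'I_n} | (k + M <= #|N|)%N].
pose Us := [seq (local_code :&: vanish N)%VS | N <- Ns].
have RI p : ~~ (R p \subset I).
  have /card_gt0P[x xR] : (0 < #|R p|)%N by rewrite cardR.
  apply/subsetPn; exists x => //; apply/imsetP => -[i _ xi].
  by have := hubR i p; rewrite -xi xR.
have [|||C [CL dC CUs]] := exists_subspace_avoiding
    (W := local_code) (U0 := (local_code :&: vanish I)%VS) (Us := Us) (k := k).
- rewrite size_map /= (leq_ltn_trans _ ltF) // addn1 ltnS -cardE.
  by rewrite (leq_trans (max_card _)) // -cardsT -powersetT card_powerset cardsT card_ord.
- by apply: (map_f (fun N => local_code :&: vanish N)%VS (x := I)); rewrite mem_head.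
- move=> _ /mapP[N NNs ->]; split; first exact: capvSl.
  move: NNs; rewrite inE mem_enum inE => /predU1P[->|leN].
    by rewrite -(dim_local_code_vanish RI) cI.
  exact: dim_local_code_vanish_le ltM leN.
have C0 N : N \in Ns -> (C :&: vanish N = 0)%VS.
  move=> NNs; apply/eqP; rewrite -subv0 -(CUs _ (map_f _ NNs)).
  by rewrite subv_cap capvSl subv_cap capvSr (subv_trans (capvSl _ _)).
have [J [N [cJ cN JN]]] := exists_independent_closure t_gt0 k_gt0 leM.
exists C; split=> //; last 1 first.
- by rewrite -cN -[X in (_ <= X)%N]card_ord max_card.
(* Only [k - 1] conditions are imposed on a space of dimension [k]; the surviving word then vanishes
   on all of [N]. *)
- have : (0 < \dim (C :&: vanish J))%N.
    by have := dim_vanish C J; rewrite dC cJ; lia.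
  rewrite lt0n dimv_eq0 => nzCJ; rewrite -cN.
  apply: (@min_distance_vanish C N (vpick (C :&: vanish J)%VS)); last first.
  + move=> N' ltN; apply: C0; rewrite inE mem_enum inE.
    by apply/orP; right; rewrite cN in ltN; lia.
  + by rewrite vpick0.
  + have /memv_capP[cC cJv] := memv_pick (C :&: vanish J)%VS.
    apply/memv_capP; split=> //; apply: (subvP JN); apply/memv_capP; split=> //.
    exact: (subvP CL).
- by apply: C0; rewrite mem_head.
Qed.

End LocalCode.

(** * The value of [mu] and the placement of hubs and repair sets *)

Lemma mu_div (k r delta : nat) :
    (0 < k)%N -> (0 < r)%N -> (0 < delta)%N ->
  mu k r delta = ((k - 1) * (delta - 1) %/ ((r - 1) * (delta - 1) + 1))%N%:Z.
Proof.
move=> k_gt0 r_gt0 delta_gt0.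
have predE m : (0 < m)%N -> m%:R - 1 = (m - 1)%:R :> rat by move=> ?; rewrite natrB.
rewrite /mu !predE //.
set a := ((k - 1) * (delta - 1))%N; set b := ((r - 1) * (delta - 1) + 1)%N.
have -> : ((k - 1)%:R * (delta - 1)%:R + 1) / ((r - 1)%:R * (delta - 1)%:R + 1)
          = a.+1%:R / b%:R :> rat by rewrite -[a.+1]addn1 /a /b !natrD !natrM.
have b_gt0 : (0 < b)%N by rewrite /b addn1.
(* For natural numbers, the ceiling of [(a + 1) / b] is the floor of [a / b] plus one. *)
rewrite (@ceil_def _ _ ((a %/ b)%N%:Z + 1)) ?addrK //.
rewrite -[_ + 1]/((a %/ b + 1)%N%:Z) !pmulrn.
rewrite ltr_pdivlMr ?ler_pdivrMr ?ltr0n // -!natrM ltr_nat ler_nat.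
by rewrite ltnS leq_divM addn1 ltn_ceil.
Qed.

Theorem corollary1 (k r delta : nat) (hr : (2 <= r)%N) (hdelta : (2 <= delta)%N)
    (hrk : (r < k)%N) (n : nat) (hn : (k * (r * (delta - 1) + 1) <= n)%N) :
  exists q0 : nat, forall F : finFieldType, (q0 <= #|F|)%N ->
    exists (d : nat) (C : {vspace 'rV[F]_n}), optimal_code k d r delta C.
Proof.
pose t := (delta - 1)%N; pose b := ((r - 1) * t + 1)%N; pose M := ((k - 1) * t %/ b)%N.
exists (2 ^ n + 2)%N => F; rewrite addn2 => leF.
(* Labels for the [k] hubs and the [k * t * r] repair coordinates, sent by [e] to the first
   [k * (r * t + 1)] positions; the other positions enter no check. *)
pose T := ('I_k + ('I_k * 'I_t) * 'I_r)%type.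
have leT : (#|{: T}| <= n)%N.
  by rewrite card_sum !card_prod !card_ord; rewrite /t; lia.
pose e (x : T) := widen_ord leT (enum_rank x).
have e_inj : injective e by move=> x y /(congr1 val) xy; apply/enum_rank_inj/val_inj.
pose hub i := e (inl i); pose R p := [set e (inr (p, s)) | s : 'I_r].
have hub_inj : injective hub by move=> i j /e_inj[].
have hubR i p : hub i \notin R p by apply/imsetP => -[s _ /e_inj].
have disjR p q : p != q -> [disjoint R p & R q].
  move=> pq; rewrite -setI_eq0; apply/eqP/setP => j; rewrite !inE; apply/negP.
  move=> /andP[/imsetP[s _ ->] /imsetP[s' _ /e_inj[/eqP]]].
  by rewrite (negPf pq).
have cardR p : #|R p| = r.
  by rewrite card_imset ?card_ord // => s s' /e_inj[].
have t_gt0 : (0 < t)%N by rewrite subn_gt0.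
have [|||||C [CL dC minC CI leMn]] :=
  @exists_optimal_subcode F n k t r hub R _ hub_inj hubR disjR cardR M t_gt0.
- exact: ltnW.
- by lia.
- exact: leq_divM.
- by rewrite ltn_ceil // /b addn1.
- by rewrite addn1.
exists (n - (k - 1 + M))%N, C; split=> //.
- have [G genG] := exists_generator_matrix dC.
  exists G; split=> //; exists (hub @: [set: 'I_k]); split.
    exact: (generator_hub_rank hub_inj genG CI).
  move=> _ /imsetP[i _ ->]; exists (fun x => R (i, x)); split.
    by move=> x y xy; apply: disjR; apply: contra xy => /eqP[->].
  move=> x; split; [exact: hubR | by rewrite cardR |].
  exact: (generator_locality (i, x) CL genG).
- rewrite mu_div; try lia; rewrite -/t -/b -/M; lia.
Qed.
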